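(* Let $k$ be a field, $V=k[t,t^{-1}]$ and $e_n=t^n$ for $n\in\mathbb Z$. For all $a,b\in\mathbb Z$, the coefficient formula $$\{\!\{e_a,e_b\}\!\}_1=\sum_{r\in\mathbb Z}e_r\otimes P_1(E_{ar})(e_b)$$ is a finite sum (only finitely many summands are nonzero) and gives exactly the double bracket $$\{\!\{e_a,e_b\}\!\}_1=\begin{cases}\displaystyle\sum_{j=a}^{b-1}e_j\otimes e_{a+b-j}, & a<b,\\[1em] \displaystyle-\sum_{j=b}^{a-1}e_j\otimes e_{a+b-j}, & a>b,\\[1em] 0,& a=b.\end{cases}$$
   Context: $k$ is a field and $V=k[t,t^{-1}]$ has basis $e_n=t^n$, $n\in\mathbb Z$. For $i,j\in\mathbb Z$, $E_{ij}\in\operatorname{End}(V)$ is the matrix unit $E_{ij}(e_m)=\delta_{jm}e_i$. Let $I_{\mathbb Z}=\operatorname{Span}_k\{E_{ij}: i,j\in\mathbb Z\}$ be the finitary matrix algebra, and let $\operatorname{End}_{\mathrm{rcf}}(V)$ be the algebra of $\mathbb Z\times\mathbb Z$ matrices having only finitely many nonzero entries in every row and every column (acting on $V$ in the basis $(e_n)$). The linear map $P_1\colon I_{\mathbb Z}\to\operatorname{End}_{\mathrm{rcf}}(V)$ is defined on matrix units by $$P_1(E_{ij})=\begin{cases}\displaystyle\sum_{p\ge1}E_{i+p,j+p}, & i\le j,\\[0.8em] \displaystyle-\sum_{p\ge0}E_{i-p,j-p}, & i>j,\end{cases}$$ where the infinite sums are understood pointwise: applied to a fixed basis vector, at most one summand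 acts nontrivially. *)

(* Defs.v *)
From HB Require Import structures.
From mathcomp Require Import all_boot all_order all_algebra finmap.
From mathcomp Require Import monalg.
From mathcomp Require Import mathcomp_extra boolp classical_sets functions.
From mathcomp Require Import cardinality fsbigop.

Set Implicit Arguments.
Unset Strict Implicit.
Unset Printing Implicit Defensive.

Import Order.TTheory GRing.Theory Num.Theory.

Local Open Scope classical_set_scope.
Local Open Scope ring_scope.

(* Linear extension to the free module {malg k[K]} of a map on its basis K. *)
Section FreeModule.
Variables (k : comNzRingType) (K : choiceType) (W : lmodType k).
Implicit Types (F : K -> W) (u v : {malg k[K]}).

Definition mlin F u : W := \sum_(i <- msupp u) u@_i *: F i.

Lemma mlinEw F u (d : {fset K}) : (msupp u `<=` d)%fset ->
  mlin F u = \sum_(i <- d) u@_i *: F i.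
Proof.
move=> sud; rewrite /mlin; apply: big_fset_incl => // i _.
by move=> /mcoeff_outdom ->; rewrite scale0r.
Qed.

Lemma mlin_is_linear F : linear (mlin F).
Proof.
move=> c u v; pose d := (msupp (c *: u + v) `|` msupp u `|` msupp v)%fset.
have [d1 d2 d3] : [/\ (msupp (c *: u + v) `<=` d)%fset,
  (msupp u `<=` d)%fset & (msupp v `<=` d)%fset].
  by split; apply/fsubsetP => i; rewrite !in_fsetU => ->; rewrite ?orbT.
rewrite (mlinEw _ d1) (mlinEw _ d2) (mlinEw _ d3).
rewrite scaler_sumr -big_split; apply: eq_bigr => i _.
by rewrite mcoeffD mcoeffZ scalerDl scalerA.
Qed.

HB.instance Definition _ F :=
  GRing.isLinear.Build k {malg k[K]} W *:%R (mlin F) (mlin_is_linear F).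

Lemma mlinU F i : mlin F << i >> = F i.
Proof.
by rewrite (@mlinEw _ _ [fset i]%fset) ?msuppU_le// big_seq_fset1 mcoeffUU scale1r.
Qed.

Lemma malg_linE (f : {linear {malg k[K]} -> W}) u :
  f u = mlin (fun i => f << i >>) u.
Proof.
rewrite {1}[u]monalgE linear_sum; apply: eq_bigr => i _.
rewrite -linearZ; congr (f _); apply/malgP => j.
by rewrite mcoeffZ !mcoeffU mulr_natr.
Qed.

Lemma malg_lin_ext (f g : {linear {malg k[K]} -> W}) :
  (forall i, f << i >> = g << i >>) -> f =1 g.
Proof.
move=> fg u; rewrite malg_linE (malg_linE g).
by apply: eq_bigr => i _; rewrite fg.
Qed.

End FreeModule.

(* k[t, t^-1] as finitely supported families of coefficients on Z; the class
   {malg k[int]} itself carries no product because the exponents in monalg are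
   required to have no nontrivial invertible element. *)
Definition laurent (k : fieldType) := {malg k[int]}.
HB.instance Definition _ (k : fieldType) := GRing.Lmodule.on (laurent k).

Section Laurent.
Variable k : fieldType.
Implicit Types (u v w : laurent k) (m n : int).

Definition e n : laurent k := << n >>.

Definition lmul u v : laurent k := mlin (fun m => mlin (fun n => e (m + n)) v) u.

Lemma laurent_ext (W : lmodType k) (f g : {linear laurent k -> W}) :
  (forall n, f (e n) = g (e n)) -> f =1 g.
Proof. exact: malg_lin_ext. Qed.

Lemma lmul_linear_l v : linear (lmul^~ v).
Proof. by move=> c u w; rewrite /lmul linearP. Qed.

Lemma lmul_linear_r u : linear (lmul u).
Proof.
move=> c v w; rewrite /lmul /mlin scaler_sumr -big_split; apply: eq_bigr => m _.
by rewrite -!/(mlin _ _) linearP scalerDr !scalerA mulrC.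
Qed.

HB.instance Definition _ u := GRing.isLinear.Build k (laurent k) (laurent k)
  *:%R (lmul u) (lmul_linear_r u).

Definition lmulr v u := lmul u v.

HB.instance Definition _ v := GRing.isLinear.Build k (laurent k) (laurent k)
  *:%R (lmulr v) (lmul_linear_l v).

Lemma lmul_e m n : lmul (e m) (e n) = e (m + n).
Proof. by rewrite /lmul !mlinU. Qed.

Lemma lmulC : commutative lmul.
Proof.
move=> u v; apply: (laurent_ext (f := lmulr v) (g := lmul v)) => m.
apply: (laurent_ext (f := lmul (e m)) (g := lmulr (e m))) => n.
by rewrite /= /lmulr !lmul_e addrC.
Qed.

Lemma lmulA : associative lmul.
Proof.
have A3 m n w : lmul (e m) (lmul (e n) w) = lmul (lmul (e m) (e n)) w.
  move: w; apply: (laurent_ext (f := lmul (e m) \o lmul (e n))) => p.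
  by rewrite /= !lmul_e addrA.
have A2 m v w : lmul (e m) (lmul v w) = lmul (lmul (e m) v) w.
  move: v; apply: (laurent_ext (f := lmul (e m) \o lmulr w)
    (g := lmulr w \o lmul (e m))) => n.
  exact: A3.
move=> u v w; move: u.
apply: (laurent_ext (f := lmulr (lmul v w)) (g := lmulr w \o lmulr v)) => m.
exact: A2.
Qed.

Lemma lmul1 : left_id (e 0) lmul.
Proof.
move=> u; apply: (laurent_ext (f := lmul (e 0)) (g := idfun)) => n.
by rewrite /= lmul_e add0r.
Qed.

Lemma lmulDl : left_distributive lmul +%R.
Proof. by move=> u v w; rewrite -!/(lmulr w _) linearD. Qed.

Lemma e_neq0 n : e n != 0.
Proof. by rewrite /e monalgU_eq0 oner_eq0. Qed.

HB.instance Definition _ := GRing.Zmodule_isComNzRing.Build (laurent k)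
  lmulA lmulC lmul1 lmulDl (e_neq0 0).

Lemma e0 : e 0 = 1. Proof. by []. Qed.
Lemma eD m n : e (m + n) = e m * e n. Proof. by rewrite -lmul_e. Qed.

End Laurent.

(* V (x) V is the free module on the pairs (i, j), standing for e_i (x) e_j;
   tensor_universal is the universal property. *)
Definition laurent2 (k : fieldType) := {malg k[(int * int)%type]}.
HB.instance Definition _ (k : fieldType) := GRing.Lmodule.on (laurent2 k).

Definition tensor (k : fieldType) (u v : laurent k) : laurent2 k :=
  mlin (fun i => mlin (fun j => << (i, j) >>) v) u.

Notation "u ⊗ v" := (tensor u v) (at level 40, left associativity) : ring_scope.

Section Tensor.
Variable k : fieldType.
Implicit Types (u v w : laurent k) (i j : int).

Lemma tensor_e i j : e k i ⊗ e k j = << (i, j) >>.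
Proof. by rewrite /tensor !mlinU. Qed.

Lemma tensor_linear_l v : linear ((@tensor k)^~ v).
Proof. by move=> c u w; rewrite /tensor linearP. Qed.

Lemma tensor_linear_r u : linear (tensor u).
Proof.
move=> c v w; rewrite /tensor /mlin scaler_sumr -big_split; apply: eq_bigr => i _.
by rewrite -!/(mlin _ _) linearP scalerDr !scalerA mulrC.
Qed.

Lemma tensor_universal (W : lmodType k) (b : laurent k -> laurent k -> W) :
    (forall v, linear (b^~ v)) -> (forall u, linear (b u)) ->
  exists! f : laurent2 k -> W, linear f /\ forall u v, f (u ⊗ v) = b u v.
Proof.
move=> bl br; pose F (ij : (int * int)%type) := b (e k ij.1) (e k ij.2).
exists (mlin F); split; first split; first exact: mlin_is_linear.
  move=> u v; rewrite /tensor.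
  pose bv := HB.pack (b^~ v) (GRing.isLinear.Build k _ _ *:%R _ (bl v))
    : {linear laurent k -> W}.
  rewrite linear_sum -[RHS]/(bv u) [RHS]malg_linE; apply: eq_bigr => i _.
  rewrite linearZ; congr (_ *: _).
  pose bi := HB.pack (b (e k i)) (GRing.isLinear.Build k _ _ *:%R _ (br (e k i)))
    : {linear laurent k -> W}.
  rewrite -[RHS]/(bi v) linear_sum [RHS]malg_linE; apply: eq_bigr => j _.
  by rewrite linearZ /= mlinU.
move=> g [glin gb]; apply/funext => x.
pose g' := HB.pack g (GRing.isLinear.Build k _ _ *:%R g glin)
  : {linear laurent2 k -> W}.
apply: (malg_lin_ext (f := mlin F) (g := g')) => -[i j].
by rewrite [LHS]mlinU -tensor_e [RHS]gb.
Qed.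

End Tensor.

Section Matrices.
Variable k : fieldType.
Local Notation V := (laurent k).
Implicit Types (f g : V -> V) (v : V) (i j m n p : int).

Definition Eop i j : V -> V := fun v => v@_j *: e k i.

Lemma Eop_linear i j : linear (Eop i j).
Proof. by move=> c u v; rewrite /Eop mcoeffD mcoeffZ scalerDl scalerA. Qed.

Lemma Eop_e i j m : Eop i j (e k m) = if m == j then e k i else 0.
Proof. by rewrite /Eop /e mcoeffU; case: eqP; rewrite ?scale1r ?scale0r. Qed.

Definition mentry f i j : k := (f (e k j))@_i.

Definition rcf_pred : {pred V -> V} := fun f => `[< [/\ linear f,
  forall i, finite_set [set j | mentry f i j != 0] &
  forall j, finite_set [set i | mentry f i j != 0]] >].

Definition IZ_pred : {pred V -> V} := fun f =>
  `[< exists c : {malg k[(int * int)%type]}, f = mlin (fun ij => Eop ij.1 ij.2) c >].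

Lemma rcf_submod : submod_closed rcf_pred.
Proof.
split.
  apply/asboolP; split=> [c u v|i|j]; first by rewrite scaler0 addr0.
    rewrite (_ : [set _ | _] = set0)//; apply/seteqP; split=> j //=.
    by rewrite /mentry mcoeff0 eqxx.
  rewrite (_ : [set _ | _] = set0)//; apply/seteqP; split=> i //=.
  by rewrite /mentry mcoeff0 eqxx.
move=> c f g /asboolP[lf rf cf] /asboolP[lg rg cg]; apply/asboolP.
have sub i j : mentry (c *: f + g) i j != 0 ->
    mentry f i j != 0 \/ mentry g i j != 0.
  have -> : mentry (c *: f + g) i j = c * mentry f i j + mentry g i j.
    by rewrite /mentry -mcoeffZ -mcoeffD.
  have [->|] := eqVneq (mentry f i j) 0; last by left.
  by rewrite mulr0 add0r; right.
split=> [a u v|i|j].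
- rewrite -[LHS]/(c *: f (a *: u + v) + g (a *: u + v)).
  rewrite -[RHS]/(a *: (c *: f u + g u) + (c *: f v + g v)).
  rewrite lf lg !scalerDr !scalerA (mulrC a) -!addrA; congr (_ + _).
  by rewrite addrCA.
- apply: (@sub_finite_set _ _ ([set j | mentry f i j != 0] `|`
      [set j | mentry g i j != 0])); last by rewrite finite_setU.
  by move=> j /sub.
- apply: (@sub_finite_set _ _ ([set i | mentry f i j != 0] `|`
      [set i | mentry g i j != 0])); last by rewrite finite_setU.
  by move=> i /sub.
Qed.

Lemma IZ_submod : submod_closed IZ_pred.
Proof.
split; first by apply/asboolP; exists 0; rewrite linear0.
move=> a f g /asboolP[c ->] /asboolP[d ->]; apply/asboolP.
by exists (a *: c + d); rewrite linearP.
Qed.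

HB.instance Definition _ := GRing.isSubmodClosed.Build k (V -> V) rcf_pred rcf_submod.
HB.instance Definition _ := GRing.isSubmodClosed.Build k (V -> V) IZ_pred IZ_submod.

Record rcf := Rcf { rcf_fun :> V -> V; rcfP : rcf_fun \in rcf_pred }.
HB.instance Definition _ := [isSub for rcf_fun].
HB.instance Definition _ := [Choice of rcf by <:].
HB.instance Definition _ := [SubChoice_isSubLmodule of rcf by <:].

Record IZ := Iz { IZ_fun :> V -> V; IZP : IZ_fun \in IZ_pred }.
HB.instance Definition _ := [isSub for IZ_fun].
HB.instance Definition _ := [Choice of IZ by <:].
HB.instance Definition _ := [SubChoice_isSubLmodule of IZ by <:].

Lemma E_subproof i j : Eop i j \in IZ_pred.
Proof. by apply/asboolP; exists << (i, j) >>; rewrite mlinU. Qed.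

Definition E i j : IZ := Iz (E_subproof i j).


Lemma Eop_coef i j v n : (Eop i j v)@_n = v@_j *+ (i == n).
Proof. by rewrite /Eop mcoeffZ /e mcoeffU mulrnAr mulr1. Qed.

Section DiagonalSum.
Variables (D : set int) (h : int -> int) (hK : involutive h) (i j : int).

Lemma diag_support v p : p \notin [seq h (m - j) | m <- msupp v] ->
  Eop (i + h p) (j + h p) v = 0.
Proof.
move=> pv; rewrite /Eop mcoeff_outdom ?scale0r//; apply: contra pv => pv.
by apply/mapP; exists (j + h p) => //; rewrite addrAC subrr add0r hK.
Qed.

Lemma diag_finite v :
  finite_set (D `&` [set p | Eop (i + h p) (j + h p) v != 0]).
Proof.
apply: (@sub_finite_set _ _ [set` [seq h (m - j) | m <- msupp v]]); last first.
  exact: finite_seq.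
by move=> p [_ /=]; apply: contraNT => /diag_support ->.
Qed.

Lemma diag_coef v n : (\sum_(p \in D) Eop (i + h p) (j + h p) v)@_n =
  if h (n - i) \in D then v@_(n - i + j) else 0.
Proof.
set r := [seq h (m - j) | m <- msupp v].
have ur : uniq r.
  by rewrite map_inj_uniq ?fset_uniq// => x y /(can_inj hK) /addIr.
have -> : \sum_(p \in D) Eop (i + h p) (j + h p) v =
    \sum_(p <- r | p \in D) Eop (i + h p) (j + h p) v.
  rewrite (@bigfs _ _ _ _ r (fun p => p \in D))// ?set_mem_set//.
  by move=> p _; apply: diag_support.
rewrite raddf_sum /=.
have kE p : (i + h p == n) = (p == h (n - i)).
  by rewrite -[RHS](inj_eq (can_inj hK)) hK eq_sym [RHS]eq_sym subr_eq addrC.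
under eq_bigr do rewrite Eop_coef kE.
have [hr|hr] := boolP (h (n - i) \in r).
  rewrite big_mkcond (bigD1_seq (h (n - i)))//= eqxx big1 ?addr0.
    by rewrite hK [j + _]addrC.
  by move=> p /negbTE ->; rewrite mulr0n if_same.
rewrite big1_seq; last first.
  move=> p /andP[_ pr]; have [ph|//] := eqVneq p (h (n - i)).
  by rewrite -ph pr in hr.
case: ifP => // _; rewrite mcoeff_outdom//; apply: contra hr => hr.
by apply/mapP; exists (n - i + j) => //; rewrite addrK.
Qed.

End DiagonalSum.

(* The infinite sums are taken pointwise: applied to a vector they have finite
   support (diag_finite), on which \sum_(p \in _) is the sum. *)
Definition P1sum i j : V -> V := fun v =>
  if i <= j then \sum_(p \in [set p : int | 1 <= p]) Eop (i + p) (j + p) v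
  else - \sum_(p \in [set p : int | 0 <= p]) Eop (i - p) (j - p) v.

Lemma P1sum_coef i j : exists d : int -> k,
  forall v n, (P1sum i j v)@_n = d n * v@_(n - i + j).
Proof.
rewrite /P1sum; case: (i <= j).
  exists (fun n => ((n - i) \in [set p : int | 1 <= p])%:R) => v n.
  rewrite (@diag_coef _ idfun (fun=> erefl)); case: ifP => _; first by rewrite mul1r.
  by rewrite mul0r.
exists (fun n => - ((- (n - i)) \in [set p : int | 0 <= p])%:R) => v n.
rewrite mcoeffN (@diag_coef [set p : int | 0 <= p] (fun p => - p) (@opprK _) i j).
by case: ifP => _; rewrite ?mulN1r// mulr0n oppr0 mul0r.
Qed.

Lemma P1sum_subproof i j : P1sum i j \in rcf_pred.
Proof.
have [d dE] := P1sum_coef i j.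
have E0 a b : mentry (P1sum i j) a b != 0 -> b = a - i + j.
  rewrite /mentry dE /e mcoeffU; have [//|_] := eqVneq b (a - i + j).
  by rewrite mulr0n mulr0 eqxx.
apply/asboolP; split=> [c u v|a|b].
- by apply/malgP => n; rewrite mcoeffD mcoeffZ !dE mcoeffD mcoeffZ mulrDr mulrCA.
- apply: (@sub_finite_set _ _ [set a - i + j]); last exact: finite_set1.
  by move=> b /E0.
- apply: (@sub_finite_set _ _ [set b - j + i]); last exact: finite_set1.
  by move=> a /E0 ->; rewrite /= addrK subrK.
Qed.

Definition P1unit i j : rcf := Rcf (P1sum_subproof i j).

(* Every f in IZ is the finite sum of its entries times matrix units, so P1 is
   the linear map with P1 (E i j) = P1unit i j (P1_is_linear, P1_E). *)
Definition P1 (f : IZ) : rcf :=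
  \sum_(ij \in [set: (int * int)%type])
    mentry f ij.1 ij.2 *: P1unit ij.1 ij.2.

Let Emx (c : {malg k[(int * int)%type]}) : V -> V :=
  mlin (fun ij => Eop ij.1 ij.2) c.

Lemma mentry_span c i j : mentry (Emx c) i j = c@_(i, j).
Proof.
rewrite /mentry /Emx /mlin fct_sumE raddf_sum /=.
have cE ab : ((c@_ab *: Eop ab.1 ab.2) (e k j))@_i = c@_ab *+ (ab == (i, j)).
  case: ab => a b; rewrite -[X in mcoeff _ X]/(c@_(a, b) *: Eop a b (e k j)).
  rewrite mcoeffZ Eop_coef /e mcoeffU -mulrnA mulnb xpair_eqE mulrnAr mulr1.
  by rewrite [j == b]eq_sym andbC.
rewrite (eq_bigr _ (fun ab _ => cE ab)).
have [ijc|ijc] := boolP ((i, j) \in msupp c).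
  rewrite (bigD1_seq (i, j)) ?fset_uniq//= eqxx big1 ?addr0// => ab.
  by move=> /negbTE ->.
rewrite big1_seq; first by rewrite mcoeff_outdom.
move=> ab /andP[_ abc]; have [ab_ij|//] := eqVneq ab (i, j).
  by rewrite ab_ij (negbTE ijc) in abc.
Qed.

Lemma P1_span (f : IZ) c : f = Emx c :> (V -> V) ->
  P1 f = mlin (fun ij => P1unit ij.1 ij.2) c.
Proof.
move=> fc; rewrite /P1 /mlin.
rewrite (@fsbigTE _ _ _ _ (msupp c)); last first.
  by move=> [i j] ijc; rewrite fc mentry_span mcoeff_outdom// scale0r.
by apply: eq_bigr => -[i j] _; rewrite fc mentry_span.
Qed.

Lemma P1_is_linear : linear P1.
Proof.
move=> a f g; have /asboolP[c fc] := IZP f; have /asboolP[d gd] := IZP g.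
rewrite (P1_span fc) (P1_span gd) (@P1_span _ (a *: c + d)) ?linearP//.
by rewrite -[LHS]/(a *: (f : V -> V) + (g : V -> V)) fc gd /Emx linearP.
Qed.

HB.instance Definition _ := GRing.isLinear.Build k IZ rcf *:%R P1 P1_is_linear.

Lemma P1_E i j : P1 (E i j) = P1unit i j.
Proof. by rewrite (@P1_span _ << (i, j) >>) ?mlinU//= /Emx mlinU. Qed.

Definition dbr1 (a b : int) : laurent2 k :=
  \sum_(r \in [set: int]) e k r ⊗ P1 (E a r) (e k b).

End Matrices.

(* Main.v *)
(* At e_b at most one term of the diagonal sum P_1(E_{ar}) survives: p = b - r if
   a <= r, which requires r < b, and p = r - b if r < a, which requires b <= r.
   Both terms are multiples of e_{a+b-r}. *)
Require Import Defs.
From mathcomp Require Import all_boot all_order all_algebra finmap monalg.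
From mathcomp Require Import boolp classical_sets functions cardinality fsbigop.
From mathcomp Require Import zify.

Import Order.TTheory GRing.Theory Num.Theory.

Local Open Scope classical_set_scope.
Local Open Scope ring_scope.

(** Only the term with [j + h p = m] acts on [e k m], that is [p = h (m - j)] since [h] is an
    involution. Taking [h] as the identity or as negation covers both branches of [P1sum]. *)
Lemma diag_sum_e (k : fieldType) (D : set int) (h : int -> int) (i j m : int) :
  involutive h ->
  \sum_(p \in D) Eop (i + h p) (j + h p) (e k m) =
    if h (m - j) \in D then e k (i + m - j) else 0.
Proof.
move=> hK; apply/malgP => n; rewrite (@diag_coef k D h hK i j) /e mcoeffU.
have [nE|nN] := eqVneq m (n - i + j).
  rewrite (_ : m - j = n - i); last by lia.
  by case: ifP => _; rewrite ?mcoeff0// mcoeffU (_ : _ == n)//; lia.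
rewrite if_same; case: ifP => _; rewrite ?mcoeff0// mcoeffU.
by rewrite (_ : _ == n = false)//; lia.
Qed.

Lemma in_set_pred (T : Type) (P : pred T) (x : T) : (x \in [set y | P y]) = P x.
Proof. by apply/idP/idP; rewrite in_setE. Qed.

Lemma fsumrN (U : zmodType) (I : choiceType) (D : set I) (F : I -> U) :
  finite_set D -> \sum_(i \in D) - F i = - \sum_(i \in D) F i.
Proof. by move=> fD; rewrite !(fsbig_finite _ _ fD)/= sumrN. Qed.

(** The guards are the two index ranges of the target formula; the first is nonempty only if
    [a < b], the second only if [b < a]. *)
Lemma P1_E_e (k : fieldType) (a r b : int) :
  P1 (E k a r) (e k b) =
    if a <= r <= b - 1 then e k (a + b - r)
    else if b <= r <= a - 1 then - e k (a + b - r) else 0.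
Proof.
rewrite P1_E /= /P1sum; case: (leP a r) => ar.
  rewrite (@diag_sum_e k _ idfun)//= in_set_pred /=.
  rewrite (_ : (1 <= b - r) = (r <= b - 1)); last by lia.
  by rewrite (_ : b <= r <= a - 1 = false)//; lia.
rewrite (@diag_sum_e k _ -%R a r b opprK) in_set_pred /=.
rewrite (_ : (0 <= - (b - r)) = (b <= r <= a - 1)); last by lia.
by case: ifP; rewrite ?oppr0.
Qed.

Lemma finite_int_segment (a b : int) : finite_set [set j : int | a <= j <= b].
Proof.
(* For [b < a - 1] the absolute value makes this list too long, which is harmless for an
   inclusion. *)
apply: (@sub_finite_set _ _ [set` [seq a + n%:Z | n <- iota 0 `|b - a + 1|]]).
  move=> j /= /andP[aj jb]; apply/mapP; exists `|j - a|%N; last by lia.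
  by rewrite mem_iota; lia.
exact: finite_seq.
Qed.

Lemma tensor0r (k : fieldType) (u : laurent k) : u ⊗ 0 = 0.
Proof. by have := tensor_linear_r u (-1) 0 0; rewrite scaler0 add0r scaleN1r addNr. Qed.

Lemma tensorNr (k : fieldType) (u v : laurent k) : u ⊗ (- v) = - (u ⊗ v).
Proof.
by have := tensor_linear_r u (-1) v 0; rewrite tensor0r !addr0 !scaleN1r.
Qed.

Theorem proposition5p1 (k : fieldType) (a b : int) :
  finite_set [set r : int | e k r ⊗ P1 (E k a r) (e k b) != 0] /\
  dbr1 k a b =
    if a < b then
      \sum_(j \in [set j : int | a <= j <= b - 1]) e k j ⊗ e k (a + b - j)
    else if b < a then
      - \sum_(j \in [set j : int | b <= j <= a - 1]) e k j ⊗ e k (a + b - j)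
    else 0.
Proof.
split.
  (* Finite support makes [dbr1] a genuine sum: over an infinite support [\sum_(r \in _)] is 0 by
     convention. *)
  apply: (@sub_finite_set _ _ ([set j | a <= j <= b - 1] `|`
      [set j | b <= j <= a - 1])); last first.
    by rewrite finite_setU; split; apply: finite_int_segment.
  move=> r /=; rewrite P1_E_e; case: ifP => [_ _|_]; first by left.
  by case: ifP => [_ _|_]; [right | rewrite tensor0r eqxx].
have dbr1_restrict (D : set int) :
    (forall r, ~ D r -> e k r ⊗ P1 (E k a r) (e k b) = 0) ->
    dbr1 k a b = \sum_(r \in D) e k r ⊗ P1 (E k a r) (e k b).
  by move=> D0; apply/esym/fsbig_widen => // r [_ /D0].
case: ltP => [ab|ba].
  rewrite (dbr1_restrict [set j | a <= j <= b - 1]) => [|r /= /negP/negbTE rN].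
    by apply: eq_fsbigr => r; rewrite in_set_pred P1_E_e => ->.
  (* Outside the first range the term vanishes, as [a < b] empties the second. *)
  by rewrite P1_E_e rN ifF ?tensor0r//; lia.
case: ltP => [{}ba|ab].
  rewrite (dbr1_restrict [set j | b <= j <= a - 1]) => [|r /= /negP/negbTE rN].
    rewrite -fsumrN; last exact: finite_int_segment.
    apply: eq_fsbigr => r; rewrite in_set_pred => rP.
    by rewrite P1_E_e ifF ?rP ?tensorNr//; lia.
  by rewrite P1_E_e rN ifF ?tensor0r//; lia.
(* Here [a = b], so both ranges are empty. *)
by apply: fsbig1 => r _; rewrite P1_E_e !ifF ?tensor0r//; lia.
Qed.
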